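(* Let $\underline{T}:\mathbb{R}^{\mathcal{X}}\to\mathbb{R}^{\mathcal{X}}$ be a map that satisfies the coherence conditions C1, C2, C3 (listed in the context). If the equation $h = \mathbb{I}_{A^c} + \mathbb{I}_{A^c}\cdot\underline{T}\,h$ has a unique solution $\underline{h}$ in $\mathbb{R}^{\mathcal{X}}$, and if $\underline{h}$ is non-negative, then $\underline{h}$ is the minimal non-negative solution of this equation in $(\mathbb{R}\cup\{+\infty\})^{\mathcal{X}}$; that is, $\underline{h}(x)\leq h(x)$ for all $x\in\mathcal{X}$ and all non-negative $h\in(\mathbb{R}\cup\{+\infty\})^{\mathcal{X}}$ that solve the equation.
   Context: $\mathcal{X}$ is a non-empty finite set, $A$ is a non-empty strict subset of $\mathcal{X}$, and $A^c = \mathcal{X}\setminus A$. $\mathbb{R}^{\mathcal{X}}$ is the set of all maps from $\mathcal{X}$ to $\mathbb{R}$; inequalities between such maps are pointwise, a constant is identified with the corresponding constant map, and $\cdot$ denotes pointwise multiplication. For $B\subseteq\mathcal{X}$, $\mathbb{I}_B\in\mathbb{R}^{\mathcal{X}}$ is the indicator of $B$. Coherence conditions for a (possibly non-linear) map $\underline{T}:\mathbb{R}^{\mathcal{X}}\to\mathbb{R}^{\mathcal{X}}$: C1: $\underline{T}(\alpha f)=\alpha\underline{T}f$ for all $f\in\mathbb{R}^{\mathcal{X}}$ and all real $\alpha\geq 0$; C2: $\underline{T}f+\underline{T}g\leq\underline{T}(f+g)$ for all $f,g\in\mathbb{R}^{\mathcal{X}}$; C3: $\min_{x\in\mathcal{X}}f(x)\leq\underline{T}f$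 for all $f\in\mathbb{R}^{\mathcal{X}}$. Such a map is monotone ($f\leq g$ implies $\underline{T}f\leq\underline{T}g$). For a non-negative extended-real-valued $h\in(\mathbb{R}\cup\{+\infty\})^{\mathcal{X}}$, $\underline{T}h$ is understood as the pointwise non-decreasing limit $\lim_{k\to+\infty}\underline{T}(\min\{h,k\})\in(\mathbb{R}\cup\{+\infty\})^{\mathcal{X}}$, where $\min\{h,k\}$ is the pointwise minimum (this agrees with $\underline{T}h$ when $h$ is real-valued), and the convention $0\cdot(+\infty)=0$ is used in products. *)

(* Defs.v *)
From mathcomp Require Import all_boot all_order all_algebra.
From mathcomp Require Import all_classical all_reals all_analysis.

Set Implicit Arguments.
Unset Strict Implicit.
Unset Printing Implicit Defensive.

Import Order.TTheory GRing.Theory Num.Theory.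
Import numFieldNormedType.Exports.

Local Open Scope classical_set_scope.
Local Open Scope ring_scope.

(* In [C3], the default value [f x] of the iterated minimum is itself one of the
   values of [f], so that the left-hand side is the minimum of [f] over [X]. *)
Record coherent (R : realType) (X : finType) (T : (X -> R) -> (X -> R)) : Prop :=
  Coherent {
    C1 : forall (f : X -> R) (a : R), 0 <= a -> T (a *: f) = a *: T f ;
    C2 : forall (f g : X -> R) (x : X), T f x + T g x <= T (f + g) x ;
    C3 : forall (f : X -> R) (x : X),
           \big[Num.min/f x]_(y : X) f y <= T f x }.

Definition solution (R : realType) (X : finType) (A : set X)
    (T : (X -> R) -> (X -> R)) (h : X -> R) : Prop :=
  h = \1_(~` A) + \1_(~` A) * T h.

(* Only meant for non-negative [h]: then [min{h, k}] takes its values in [0, k],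
   so that [fine] loses no information. *)
Definition truncate (R : realType) (X : finType) (h : X -> \bar R) (k : nat) :
    X -> R :=
  fun x => fine (Order.min (h x) (k%:R)%:E).

Definition extend (R : realType) (X : finType) (T : (X -> R) -> (X -> R))
    (h : X -> \bar R) : X -> \bar R :=
  fun x => limn (fun k : nat => (T (truncate h k) x)%:E).

(* Non-negativity excludes the value [-oo], so that these are non-negative maps
   with values in the reals extended by [+oo] only; in [\bar R], [0 * +oo = 0]. *)
Definition nonneg_ext_solution (R : realType) (X : finType) (A : set X)
    (T : (X -> R) -> (X -> R)) (h : X -> \bar R) : Prop :=
  (forall x, (0 <= h x)%E) /\
  (forall x, h x = ((\1_(~` A) x)%:E + (\1_(~` A) x)%:E * extend T h x)%E).

Definition minimal_nonneg_ext_solution (R : realType) (X : finType) (A : set X)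
    (T : (X -> R) -> (X -> R)) (h : X -> \bar R) : Prop :=
  nonneg_ext_solution A T h /\
  (forall g : X -> \bar R,
     nonneg_ext_solution A T g -> forall x, (h x <= g x)%E).

(* Main.v *)
(** Write [G h = 1_{A^c} + 1_{A^c} * T h], a monotone map.  If [g] is a
    non-negative extended solution, then [f = min(h0, g)] is real-valued and
    [G f <= f].  Hence the iterates [G^n f] decrease to some [u] with
    [0 <= u <= f], and [G u = u] because [T] is non-expansive for the sup norm.
    Uniqueness gives [u = h0], so [h0 <= f <= g]. *)

Require Import Defs.
From mathcomp Require Import all_boot all_order all_algebra.
From mathcomp Require Import all_classical all_reals all_analysis.
From mathcomp Require Import lra.

Import Order.TTheory GRing.Theory Num.Theory.
Import numFieldNormedType.Exports.

Local Open Scope classical_set_scope.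
Local Open Scope ring_scope.

Section Coherent.
Context {R : realType} {X : finType} {T : (X -> R) -> (X -> R)}.
Hypothesis cohT : coherent T.

Lemma coherent_ge (f : X -> R) (c : R) (x : X) :
  (forall y, c <= f y) -> c <= T f x.
Proof.
move=> cf; apply: le_trans (C3 cohT f x).
by elim/big_ind: _ => [//|a b ca cb|y _]; [rewrite le_min ca|].
Qed.

(** Superadditivity splits [g] as [f + (g - f)], and C3 bounds [T (g - f)] below by [c]. Taking
    [c = 0] yields monotonicity; a negative [c] yields non-expansiveness in the sup norm. *)
Lemma coherent_shift (f g : X -> R) (c : R) (x : X) :
  (forall y, f y + c <= g y) -> T f x + c <= T g x.
Proof.
move=> fcg; have -> : g = f + (g - f) by rewrite addrC subrK.
apply: le_trans (C2 cohT f (g - f) x); rewrite lerD2l; apply: coherent_ge => y.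
by have := fcg y; rewrite !fctE; lra.
Qed.

Lemma coherent_mono (f g : X -> R) (x : X) :
  (forall y, f y <= g y) -> T f x <= T g x.
Proof.
move=> fg; rewrite -[T f x]addr0.
by apply: coherent_shift => y; rewrite addr0.
Qed.

Lemma truncateE (h : X -> \bar R) (k : nat) (x : X) :
  (0 <= h x)%E -> (truncate h k x)%:E = Order.min (h x) (k%:R)%:E.
Proof.
move=> h0; rewrite /truncate fineK // ge0_fin_numE.
  by rewrite gt_min ltry orbT.
by rewrite le_min h0 lee_fin ler0n.
Qed.

Lemma truncate_le (h : X -> \bar R) (k l : nat) (x : X) :
  (0 <= h x)%E -> (k <= l)%N -> truncate h k x <= truncate h l x.
Proof.
move=> h0 kl; rewrite -lee_fin !truncateE // le_min !ge_min lexx /=.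
by rewrite lee_fin ler_nat kl orbT.
Qed.

Lemma le_truncate (f : X -> R) (h : X -> \bar R) :
  (forall x, 0 <= f x) -> (forall x, (f x)%:E <= h x)%E ->
  \forall k \near \oo, forall x, f x <= truncate h k x.
Proof.
move=> f0 fh; near=> k => x.
rewrite -lee_fin truncateE ?(le_trans _ (fh x)) ?lee_fin//.
rewrite le_min fh lee_fin /=.
(* The sum bounds all values of the non-negative [f] at once, so one threshold for [k] serves every
   [x]. *)
apply: (@le_trans _ _ (\sum_y f y)); last by near: k; exact: nbhs_infty_ger.
by rewrite (bigD1 x)//= lerDl sumr_ge0.
Unshelve. all: by end_near. Qed.

Lemma is_cvg_extend (h : X -> \bar R) (x : X) : (forall y, 0 <= h y)%E ->
  cvgn (fun k => (T (truncate h k) x)%:E).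
Proof.
move=> h0; apply: ereal_nondecreasing_is_cvgn => k l kl.
by rewrite lee_fin; apply: coherent_mono => y; exact: truncate_le.
Qed.

(** Since [f] is bounded, it lies below all late truncations of [h], and monotonicity passes this on
    to the terms of the limit. *)
Lemma le_extend (f : X -> R) (h : X -> \bar R) (x : X) :
  (forall y, 0 <= f y) -> (forall y, (f y)%:E <= h y)%E ->
  ((T f x)%:E <= extend T h x)%E.
Proof.
move=> f0 fh; apply: lime_ge.
  by apply: is_cvg_extend => y; apply: le_trans (fh y); rewrite lee_fin.
near=> k; rewrite lee_fin; apply: coherent_mono => y.
by move: y; near: k; exact: le_truncate.
Unshelve. all: by end_near. Qed.

Lemma extend_EFin (f : X -> R) (x : X) : (forall y, 0 <= f y) ->
  extend T (EFin \o f) x = (T f x)%:E.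
Proof.
move=> f0; apply/eqP; rewrite eq_le le_extend // andbT.
apply: lime_le; first by apply: is_cvg_extend => y; rewrite lee_fin.
near=> k; rewrite lee_fin; apply: coherent_mono => y.
by rewrite -lee_fin truncateE ?lee_fin// ge_min lexx.
Unshelve. all: by end_near. Qed.

Lemma solution_below (A : set X) (f : X -> R) :
  (forall x, 0 <= f x) ->
  (forall x, \1_(~` A) x + \1_(~` A) x * T f x <= f x) ->
  exists2 u, solution A T u & forall x, u x <= f x.
Proof.
move=> f_ge0 Gf_le.
pose G h : X -> R := fun x => \1_(~` A) x + \1_(~` A) x * T h x.
have ind_ge0 x : 0 <= \1_(~` A) x :> R by rewrite indicE.
have G_mono h k : (forall x, h x <= k x) -> forall x, G h x <= G k x.
  by move=> hk x; rewrite lerD2l ler_wpM2l// coherent_mono.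
pose v n := iter n G f.
have v_ge0 n x : 0 <= v n x.
  elim: n x => [//|n IHn] x; rewrite addr_ge0// mulr_ge0//.
  exact: coherent_ge.
have vS n x : v n.+1 x <= v n x.
  by elim: n x => [|n IHn] x; [exact: Gf_le|exact: G_mono].
have v_ni x : nonincreasing_seq (v^~ x) by apply/nonincreasing_seqP.
have v_cvg x : cvgn (v^~ x).
  by apply: nonincreasing_is_cvgn => //; exists 0 => _ [n _ <-].
pose u x := limn (v^~ x).
have u_le n x : u x <= v n x by exact: nonincreasing_cvgn_ge.
exists u; last exact: (u_le 0).
(* All gaps are non-negative, so [s n] dominates the sup distance from [v n] to [u]; as [X] is
   finite, it tends to 0. *)
pose s n := \sum_x (v n x - u x).
have s_cvg : s n @[n --> \oo] --> (0 : R).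
  rewrite -[0](@big1_eq _ _ +%R X (index_enum X) xpredT).
  apply: cvg_big => [|x _]; first exact: add_continuous.
  rewrite -(subrr (u x)).
  by apply: cvgB; [exact: v_cvg|exact: cvg_cst].
have vu n x : v n x - s n <= u x.
  rewrite lerBlDr -lerBlDl /s (bigD1 x)//= lerDl sumr_ge0// => y _.
  by rewrite subr_ge0.
suff Gu x : u x = G u x by apply/funext.
(* For [G u <= u], monotonicity gives [G u <= G (v n) = v n.+1 <= v n] for every [n]. *)
apply/eqP; rewrite eq_le; apply/andP; split; last first.
  apply: limr_ge; first exact: v_cvg.
  near=> n; apply: le_trans (vS n x); exact: G_mono.
(* Conversely, [u <= v n.+1 = G (v n)], and by non-expansiveness [T (v n)] exceeds [T u] by at most
   [s n], which vanishes in the limit. *)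
suff le_n n : u x <= G u x + \1_(~` A) x * s n.
  rewrite -[leRHS]addr0 -[X in _ + X](mulr0 (\1_(~` A) x)).
  have Gs_cvg : G u x + \1_(~` A) x * s n @[n --> \oo] -->
      G u x + \1_(~` A) x * 0.
    by apply: cvgD; [exact: cvg_cst|apply: cvgM; [exact: cvg_cst|]].
  rewrite -(cvg_lim _ Gs_cvg)//; apply: limr_ge.
    by apply/cvg_ex; eexists; exact: Gs_cvg.
  by near=> n.
apply: le_trans (u_le n.+1 x) _.
rewrite /= /G -addrA -mulrDr lerD2l ler_wpM2l// -lerBlDr.
exact: coherent_shift.
Unshelve. all: by end_near. Qed.

End Coherent.

Theorem corollary1 (R : realType) (X : finType) (A : set X)
    (A_neq0 : A !=set0) (A_neqT : A != setT)
    (T : (X -> R) -> (X -> R)) (cohT : coherent T)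
    (h0 : X -> R) (h0_unique : unique (solution A T) h0)
    (h0_ge0 : forall x, 0 <= h0 x) :
  minimal_nonneg_ext_solution A T (fun x => (h0 x)%:E).
Proof.
case: h0_unique => h0_sol h0_uniq.
have h0E x : h0 x = \1_(~` A) x + \1_(~` A) x * T h0 x by rewrite {1}h0_sol.
have ind_ge0 x : 0 <= \1_(~` A) x :> R by rewrite indicE.
split=> [|g [g_ge0 gE] x].
  split=> x; first by rewrite lee_fin.
  by rewrite (extend_EFin cohT)// {1}h0E.
(* The minimum lies between 0 and the real [h0 y], so [fine] keeps its value even where [g y] is
   infinite. *)
pose f y := fine (Order.min (h0 y)%:E (g y)).
have fE y : (f y)%:E = Order.min (h0 y)%:E (g y).
  rewrite fineK// ge0_fin_numE; first by rewrite gt_min ltry.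
  by rewrite le_min lee_fin h0_ge0 g_ge0.
have f_ge0 y : 0 <= f y by rewrite -lee_fin fE le_min lee_fin h0_ge0 g_ge0.
have f_le_h0 y : f y <= h0 y by rewrite -lee_fin fE ge_min lexx.
have f_le_g y : ((f y)%:E <= g y)%E by rewrite fE ge_min lexx orbT.
have [u /h0_uniq <- u_le] : exists2 u, solution A T u & forall y, u y <= f y.
  (* [G f] is compared with each argument of the minimum: [f <= h0] gives [G f <= G h0 = h0], and
     [f <= g] bounds [T f] by [extend T g], hence [G f] by [g]. *)
  apply: solution_below => // y; rewrite -lee_fin fE le_min; apply/andP; split.
    by rewrite lee_fin h0E lerD2l ler_wpM2l// coherent_mono.
  rewrite gE EFinD EFinM leeD2l// lee_wpmul2l ?lee_fin//.
  exact: le_extend.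
by apply: le_trans (f_le_g x); rewrite lee_fin.
Qed.
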